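(* Let $n\ge 2$ and let $p(z)=(z-a)\prod_{j=1}^{n-1}(z-z_j)$, where $a$ is a real number with $0\le a\le 1$ and $z_1,\ldots,z_{n-1}\in\mathbb{C}$ satisfy $|z_j|\le 1$ for $j=1,\ldots,n-1$. If furthermore $$\Re\sum_{j=1}^{n-1}z_j\ge\frac{n-2}{2}\,a,$$ then the open disk $|z-a|<1$ contains a critical point of $p(z)$.
   Context: The critical points of a polynomial $p(z)$ are the zeros of its derivative $p'(z)$. $\Re z$ denotes the real part of a complex number $z$. *)

(* Defs.v *)
From HB Require Import structures.
From mathcomp Require Import all_boot all_order all_algebra.
From mathcomp Require Import reals complex.

Set Implicit Arguments.
Unset Strict Implicit.
Unset Printing Implicit Defensive.

Import Order.TTheory GRing.Theory Num.Theory.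

Local Open Scope ring_scope.
Local Open Scope complex_scope.

Definition critical_point (R : realType) (p : {poly R[i]}) (w : R[i]) : Prop :=
  root p^`() w.

(* Main.v *)
Require Import Defs.
From HB Require Import structures.
From mathcomp Require Import all_boot all_order all_algebra.
From mathcomp Require Import reals complex.
From mathcomp Require Import ring lra.

(** Suppose that every critical point [w] of [p] satisfies [1 <= |w - a|].

    The logarithmic derivative gives the Gauss-Lucas theorem together with its
    boundary case: a critical point on or outside the unit circle has to be a
    zero of [p] ([critical_point_outside_disc]).  Zeros of [p] lie in the
    closed unit disk, so all critical points do.

    Expanding [1 <= |w - a|^2] gives [1 - |w|^2 <= a^2 - 2 a Re w].  Sum this
    over the [n - 1] critical points.  Comparing the top two coefficients of
    [p] and [p'] shows that the critical points have the same mean as the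
    zeros ([critical_points_spec]), and the hypothesis says that this mean has
    real part at least [a / 2]; hence the right-hand side sums to at most 0.
    As each [1 - |w|^2] is nonnegative, they all vanish: every critical point
    is on the unit circle, and is therefore a zero of [p].

    If all critical points are zeros of [p], then [p'] divides [p]
    ([deriv_dvdp]).  Now [a] is not a critical point, being at distance 0 from
    itself; so, writing [p = (z - a) q], the polynomial [p'] divides [q], and
    by degrees [p' = n q].  Evaluating [p' = q + (z - a) q'] at [a] gives
    [n q(a) = q(a)] with [q(a) = p'(a)] nonzero, which is absurd for
    [n >= 2]. *)

Set Implicit Arguments.
Unset Strict Implicit.
Unset Printing Implicit Defensive.

Import Order.TTheory GRing.Theory Num.Theory.

Local Open Scope ring_scope.
Local Open Scope complex_scope.

Lemma normC_sub_real_sqr (C : numClosedFieldType) (t a : C) :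
  a \is Num.real -> `|t - a| ^+ 2 = `|t| ^+ 2 - 2 * (a * 'Re t) + a ^+ 2.
Proof.
move=> aR; have aJ := conj_Creal aR.
by rewrite !normCK ReE rmorphB /= aJ; field.
Qed.

(** With [t = w / (w - x)] one has [t - 1 = x / (w - x)], so [|x| <= |w|] means
    that [t] is at least as close to 1 as to 0, i.e. that [Re t >= 1 / 2]. *)
Lemma Re_div_sub_gt0 (C : numClosedFieldType) (w x : C) :
  `|x| <= `|w| -> w != x -> 0 < 'Re (w / (w - x)).
Proof.
move=> xw; rewrite -subr_eq0; set v := w - x => v0; set t := w / v.
have tB1 : t - 1 = x / v by rewrite /t /v; field.
have: `|t - 1| ^+ 2 <= `|t| ^+ 2.
  rewrite tB1 !normf_div lerXn2r ?nnegrE ?divr_ge0 //.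
  by rewrite ler_pM2r ?invr_gt0 ?normr_gt0.
rewrite normC_sub_real_sqr ?rpred1 // expr1n mul1r -addrA gerDl addrC subr_le0.
by move=> /(lt_le_trans ltr01); rewrite pmulr_rgt0 ?ltr0n.
Qed.

Lemma deriv_prod_XsubC_horner (F : fieldType) (rs : seq F) (w : F) :
  w \notin rs ->
  (\prod_(x <- rs) ('X - x%:P))^`().[w] =
  (\prod_(x <- rs) ('X - x%:P)).[w] * \sum_(x <- rs) (w - x)^-1.
Proof.
elim: rs => [|x rs IH]; first by rewrite !big_nil derivC horner0 mulr0.
rewrite in_cons negb_or -subr_eq0 => /andP[wx /IH IHw].
rewrite !big_cons derivM derivXsubC mul1r hornerD !hornerM IHw hornerXsubC.
by field.
Qed.

(** The Gauss-Lucas theorem for disks centred at 0, boundary included.  If [w]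
    is not a zero, then [w p'(w) / p(w)] is the sum of the [w / (w - x)], each
    of which has positive real part; so [p'(w)] is nonzero. *)
Lemma critical_point_outside_disc (C : numClosedFieldType) (rs : seq C) (w : C) :
  rs != [::] -> {in rs, forall x, `|x| <= `|w|} ->
  root (\prod_(x <- rs) ('X - x%:P))^`() w -> w \in rs.
Proof.
move=> rs0 rsw; apply: contraTT => wrs.
rewrite /root deriv_prod_XsubC_horner // mulf_neq0 //.
  by rewrite -/(root _ w) root_prod_XsubC.
(* The factor [w] rotates all the terms into the same half-plane. *)
suff: 0 < 'Re (w * \sum_(x <- rs) (w - x)^-1).
  by apply: contraTneq => ->; rewrite mulr0 raddf0 ltxx.
rewrite mulr_sumr raddf_sum /=.
have pos x : x \in rs -> 0 < 'Re (w / (w - x)).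
  by move=> xrs; apply: Re_div_sub_gt0; [exact: rsw | apply: contraNneq wrs => ->].
case: rs rs0 pos {rsw wrs} => // y rs _ pos.
rewrite big_cons ltr_pwDl ?pos ?mem_head // big_seq sumr_ge0 // => x xrs.
by rewrite ltW // pos // in_cons xrs orbT.
Qed.

(** In characteristic 0, a zero of multiplicity [m + 1] of [p] has multiplicity
    exactly [m] in [p'], so a zero of [p'] contributes the same power to
    [p'] and to [gcd(p, p')].  The cofactor of the gcd in [p'] thus has no zero
    left, i.e. it is constant. *)
Lemma deriv_dvdp (C : numClosedFieldType) (p : {poly C}) :
  p^`() != 0 -> (forall w, root p^`() w -> root p w) -> p^`() %| p.
Proof.
move=> dp0 droot.
have p0 : p != 0 by apply: contraNneq dp0 => ->; rewrite derivC.
set g := gcdp p p^`().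
have /dvdpP[k dpE] : g %| p^`() by exact: dvdp_gcdr.
suff k1 : size k = 1%N.
  have /size_poly1P[c c0 kE] : size k == 1%N by rewrite k1.
  by rewrite dpE kE mul_polyC dvdpZl // dvdp_gcdl.
apply/eqP/negPn/closed_rootP => -[x kx].
have : root p x by apply: droot; rewrite dpE rootM kx.
have [[|m] [q]] := multiplicity_XsubC p x; rewrite p0 /= => qx pE.
  by rewrite pE expr0 mulr1 (negPf qx).
move=> _; have dE : p^`() =
    (q^`() * ('X - x%:P) + q *+ m.+1) * ('X - x%:P) ^+ m.
  rewrite pE derivM deriv_exp derivXsubC exprS /= mul1r mulrA [RHS]mulrDl.
  by rewrite mulrnAr mulrnAl.
have /dvdpP[h gE] : ('X - x%:P) ^+ m %| g.
  by rewrite dvdp_gcd {1}pE exprS mulrA !dvdp_mull // dE dvdp_mull.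
have Xm0 : ('X - x%:P) ^+ m != 0 by rewrite expf_neq0 // polyXsubC_eq0.
have : k * h = q^`() * ('X - x%:P) + q *+ m.+1.
  by apply: (mulIf Xm0); rewrite -mulrA -gE -dpE dE.
move=> /(congr1 (horner^~ x)); rewrite hornerM (rootP kx) mul0r.
rewrite hornerD hornerM hornerMn !hornerE subrr mulr0 add0r.
move=> /esym/eqP; rewrite mulrn_eq0 /=.
by apply/negP.
Qed.

(** The last component says that zeros and critical points have the same mean:
    the sum of the roots is read off the second coefficient, and
    differentiation multiplies the two top coefficients by [n] and [n - 1]. *)
Lemma critical_points_spec (C : numClosedFieldType) (rs : seq C) :
  (1 < size rs)%N ->
  {ws : seq C | [/\ size ws = (size rs).-1,
    (\prod_(x <- rs) ('X - x%:P))^`() =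
      (size rs)%:R *: \prod_(w <- ws) ('X - w%:P)
    & (size rs)%:R * \sum_(w <- ws) w = (size rs).-1%:R * \sum_(x <- rs) x]}.
Proof.
move=> rs1; set p := \prod_(x <- rs) _; set n := size rs in rs1 *.
have n0 : (0 < n)%N by exact: ltnW.
have nC0 : n%:R != 0 :> C by rewrite pnatr_eq0 -lt0n.
have sp : size p = n.+1 by rewrite size_prod_XsubC.
have pn : p`_n = 1.
  by have /monicP := monic_prod_XsubC rs xpredT id; rewrite lead_coefE -/p sp.
have dpn : p^`()`_n.-1 = n%:R by rewrite coef_deriv prednK // pn.
have sdp : size p^`() = n.
  apply/eqP; rewrite eqn_leq; apply/andP; split.
    rewrite -ltnS -sp lt_size_deriv // -size_poly_eq0 sp //.
  rewrite leqNgt; apply/negP => lt; move: nC0.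
  by rewrite -dpn nth_default ?eqxx // -ltnS prednK.
have [ws dpE] := closed_field_poly_normal p^`().
rewrite lead_coefE sdp dpn in dpE.
have sws : size ws = n.-1.
  by move: sdp; rewrite dpE size_scale // size_prod_XsubC => <-.
exists ws; split => //.
have : p^`()`_n.-2 = p`_n.-1 *+ n.-1 by rewrite coef_deriv prednK // -subn1 subn_gt0.
rewrite dpE coefZ -{1}sws /p !coefPn_prod_XsubC -?lt0n //; last first.
  by rewrite sws -subn1 subn_gt0.
by rewrite mulrN mulNrn => /oppr_inj ->; rewrite mulr_natl.
Qed.

(** The last hypothesis says that the mean of all the roots, [a] included, has
    real part at least [a / 2]. *)
Lemma critical_point_near_real_root (C : numClosedFieldType) (a : C)
    (zs : seq C) :
  0 <= a <= 1 -> zs != [::] -> {in zs, forall x, `|x| <= 1} ->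
  (size zs).+1%:R * a <= 2 * 'Re (\sum_(x <- a :: zs) x) ->
  exists2 w, `|w - a| < 1 &
    root (('X - a%:P) * \prod_(x <- zs) ('X - x%:P))^`() w.
Proof.
move=> /andP[a0 a1] zs0 zs_le1 hRe; have aR : a \is Num.real by exact: ger0_real.
pose rs := a :: zs; set q := \prod_(x <- zs) _.
have pE : ('X - a%:P) * q = \prod_(x <- rs) ('X - x%:P) by rewrite big_cons.
have rs_le1 x : x \in rs -> `|x| <= 1.
  by rewrite in_cons => /predU1P[->|/zs_le1 //]; rewrite ger0_norm.
have m0 : (0 < size zs)%N by rewrite lt0n size_eq0.
have [//|ws [/= sws dpE sumE]] := @critical_points_spec _ rs.
have dp_root w : root (('X - a%:P) * q)^`() w = (w \in ws).
  by rewrite pE dpE rootZ ?pnatr_eq0 // root_prod_XsubC.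
have [/hasP[w wws wa]|/hasPn ws_far] := boolP (has (fun w => `|w - a| < 1) ws).
  by exists w => //; rewrite dp_root.
exfalso.
have ws_root w : w \in ws -> 1 <= `|w| -> w \in rs.
  move=> wws w1; apply: critical_point_outside_disc => //.
    by move=> x /rs_le1 /le_trans; apply.
  by rewrite -pE dp_root.
have ws_le1 w : w \in ws -> `|w| <= 1.
  move=> wws; case: (real_leP (normr_real w) (rpred1 _)) => // w1.
  by have := rs_le1 _ (ws_root _ wws (ltW w1)); rewrite (lt_geF w1).
(* Lower bounds for [|w - a|] turn into upper bounds for the real part. *)
have ws_defect w : w \in ws -> 1 - `|w| ^+ 2 <= a ^+ 2 - 2 * (a * 'Re w).
  move=> /ws_far; rewrite -real_leNgt ?rpred1 ?normr_real // => wa.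
  have: 1 <= `|w - a| ^+ 2 by rewrite exprn_ege1.
  by rewrite normC_sub_real_sqr // lerBlDr -addrA addrC (addrC (a ^+ 2)).
have ws_ge0 w : w \in ws -> 0 <= 1 - `|w| ^+ 2.
  by move=> /ws_le1 w1; rewrite subr_ge0 expr_le1.
have ws_sum : \sum_(w <- ws) (a ^+ 2 - 2 * (a * 'Re w)) <= 0.
  have -> : \sum_(w <- ws) (a ^+ 2 - 2 * (a * 'Re w)) =
      (size zs)%:R * a ^+ 2 - 2 * (a * 'Re (\sum_(w <- ws) w)).
    rewrite sumrB [X in a * X]raddf_sum !mulr_sumr big_const_seq count_predT sws.
    rewrite iter_addr_0.
    by rewrite -[_ *+ size zs]mulr_natl.
  have nC : 0 < (size rs)%:R :> C by rewrite ltr0n.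
  have ReE2 : (size rs)%:R * 'Re (\sum_(w <- ws) w) =
      (size zs)%:R * 'Re (\sum_(x <- rs) x).
    by have := congr1 (fun u : C => 'Re u) sumE; rewrite !ReMl ?realn.
  rewrite -(pmulr_rle0 _ nC) mulrBr.
  have -> : (size rs)%:R * (2 * (a * 'Re (\sum_(w <- ws) w))) =
      (size zs)%:R * a * (2 * 'Re (\sum_(x <- rs) x)).
    transitivity (2 * a * ((size rs)%:R * 'Re (\sum_(w <- ws) w))); first by ring.
    by rewrite ReE2; ring.
  have -> : (size rs)%:R * ((size zs)%:R * a ^+ 2) =
      (size zs)%:R * a * ((size zs).+1%:R * a) by rewrite /=; ring.
  by rewrite subr_le0 ler_wpM2l // mulr_ge0 ?ler0n.
have ws_on_circle w : w \in ws -> 1 <= `|w|.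
  have : \sum_(w <- ws) (1 - `|w| ^+ 2) == 0.
    rewrite eq_le big_seq sumr_ge0 // andbT.
    by rewrite (le_trans _ ws_sum) // [leRHS]big_seq ler_sum.
  rewrite big_seq psumr_eq0 // => /allP h wws.
  have := h w wws; rewrite wws subr_eq0 eq_sym /= => /eqP w1.
  by rewrite -(@expr_ge1 _ 2) // w1.
have qE : (('X - a%:P) * q)^`() = q + ('X - a%:P) * q^`().
  by rewrite derivM derivXsubC mul1r.
(* Here [a] is a simple root: otherwise it would be a critical point at
   distance 0 from itself. *)
have dpa : ~~ root (('X - a%:P) * q)^`() a.
  rewrite dp_root; apply/negP => /ws_far; rewrite subrr normr0 ltr01 //.
have dp_dvd_q : (('X - a%:P) * q)^`() %| q.
  rewrite -(@Gauss_dvdpr _ _ ('X - a%:P)) ?coprimep_XsubC //.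
  apply: deriv_dvdp; first by apply: contraNneq dpa => ->; rewrite root0.
  move=> w; rewrite dp_root => wws; rewrite pE root_prod_XsubC.
  exact: ws_root (ws_on_circle _ wws).
have qws : \prod_(w <- ws) ('X - w%:P) = q.
  apply/eqP; rewrite -eqp_monic ?monic_prod_XsubC //.
  rewrite -dvdp_size_eqp; first by rewrite !size_prod_XsubC sws.
  by move: dp_dvd_q; rewrite pE dpE dvdpZl ?pnatr_eq0.
move: dpa; rewrite pE dpE qws rootZ ?pnatr_eq0 // => qa.
(* Now [p' = n q], which contradicts the product rule at [a]. *)
have /(congr1 (horner^~ a)) : (size rs)%:R *: q = q + ('X - a%:P) * q^`().
  by rewrite -qE pE dpE qws.
rewrite !hornerE subrr mul0r addr0 => /eqP.
rewrite /= -natr1 mulrDl mul1r -subr_eq0 addrK mulf_eq0 pnatr_eq0 -leqn0 leqNgt m0.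
by rewrite -/(root q a) (negPf qa).
Qed.

Theorem theorem4p1 (R : realType) (n : nat) (a : R) (z : 'I_n.-1 -> R[i])
    (p : {poly R[i]}) (hn : (2 <= n)%N) (ha : 0 <= a <= 1)
    (hz : forall j : 'I_n.-1, `|z j| <= 1)
    (hp : p = ('X - (a%:C)%:P) * \prod_(j < n.-1) ('X - (z j)%:P))
    (hRe : (n%:R - 2) / 2 * a <= complex.Re (\sum_(j < n.-1) z j)) :
  exists w : R[i], `|w - a%:C| < 1 /\ critical_point p w.
Proof.
pose zs := [seq z j | j <- index_enum 'I_n.-1].
have szs : size zs = n.-1 by rewrite size_map [index_enum _]unlock -enumT size_enum_ord.
have [||||w wa wp] := @critical_point_near_real_root _ a%:C zs.
- by rewrite (lecR 0 a) (lecR a 1).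
- by rewrite -size_eq0 szs -lt0n -subn1 subn_gt0.
- by move=> _ /mapP[j _ ->].
- rewrite szs (ltn_predK hn) big_cons big_map -complexRe raddfD /=.
  rewrite -(rmorph_nat (real_complex R)) -(rmorph_nat (real_complex R) 2).
  by rewrite -!rmorphM lecR; lra.
by exists w; split=> //; rewrite /critical_point hp; rewrite big_map in wp.
Qed.
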